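(* (i) Take $N\leq 6$. Every outer normal $\mu^{k}$, $1\leq k\leq h_{N}$, of $\mathcal{U}_N^*$ can be written under the form $(\mathsf{e}^k_i\mathsf{e}^k_j)_{1\leq i<j\leq N}$ for some $\mathsf{e}^k\in \mathsf{E}_{N}$. A matrix $\rho\in\mathscr{F}_{N}^1$ belongs to $\mathcal{U}_{N}$ if and only if for every $\mathsf{e}\in\mathsf{E}_{N}$, \[ \sum_{i,j=1}^{N}\rho_{ij}\mathsf{e}_{i}\mathsf{e}_{j}\geq 1. \] (ii) Let $N \geq 1$, and $\rho\in\mathcal{U}_{N}$. For every $\mathsf{e}\in \mathbb{Z}^N$ with odd sum $\sum_i\mathsf{e}_i$, $\rho$ satisfies $\sum_{i,j=1}^{N}\rho_{ij}\mathsf{e}_{i}\mathsf{e}_{j}\geq 1$.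
   Context: Let $N\geq 1$, $[N]=\{1,\dots,N\}$ and $\mathsf{B}_N=\{-1,1\}^N$. A unit field is a random element $X$ of $\mathsf{B}_N$, with unit covariance $\rho^X_{i,j}=\mathbf{E}X_iX_j$. $\mathscr{F}_N$ is the space of symmetric $N\times N$ real matrices, $\mathscr{F}_N^1$ those with all diagonal entries equal to $1$, and $\mathcal{U}_N$ the class of unit covariances of unit fields on $[N]$. Let $\pi(\rho)=(\rho_{i,j};1\leq i<j\leq N)$, $\mathscr{F}_N^*=\pi(\mathscr{F}_N)$, $\mathcal{U}_N^*=\pi(\mathcal{U}_N)$. $\mathcal{U}_N^*$ is a full-dimensional polytope in $\mathscr{F}_N^*$, written as $\bigcap_{k=1}^{h_N}\{\rho\in\mathscr{F}_N^*:\langle\rho,\mu^k\rangle\leq o_k\}$ where $h_N$ is the number of its facets, $\mu^k\in\mathscr{F}_N^*$ are its outer normals and $o_k$ the offsets. Define $\mathsf{E}_{N}=\{\mathsf{e}\in\mathbb{Z}^N:\ \sum_{i=1}^{N}\mathbf{u}_{i}\mathsf{e}_{i}=1 \text{ for some } \mathbf{u}\in \mathsf{B}_{N}\}$.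
   Formalization: Outer normals are shown to be negative multiples of (e_i e_j), e in E_N: normals are defined only up to positive scaling, and with the convention <rho,mu> <= o the sign must be negative (for N=3 the outer normal -(1,1,1) is no positive multiple of any (e_i e_j)). *)

(* Defs.v *)
From mathcomp Require Import all_boot all_order all_algebra.
From mathcomp Require Import reals.
Set Implicit Arguments. Unset Strict Implicit. Unset Printing Implicit Defensive.
Import Order.TTheory GRing.Theory Num.Theory.
Local Open Scope ring_scope.

Section UnitFields.
Variable R : realType.

(* B_N = {-1,1}^N, encoded as boolean vectors; true ↦ 1, false ↦ -1 *)
Definition signR (b : bool) : R := if b then 1 else -1.
Definition BN (N : nat) : finType := {ffun 'I_N -> bool}.

(* A unit field on [N] is determined (for covariance purposes) by its law,
   a probability distribution on B_N. *)
Definition is_law (N : nat) (p : {ffun BN N -> R}) : Prop :=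
  (forall u, 0 <= p u) /\ \sum_(u : BN N) p u = 1.

Definition unit_cov (N : nat) (p : {ffun BN N -> R}) : 'M[R]_N :=
  \matrix_(i, j) \sum_(u : BN N) p u * signR (u i) * signR (u j).

Definition in_UN (N : nat) (rho : 'M[R]_N) : Prop :=
  exists p : {ffun BN N -> R}, is_law p /\ rho = unit_cov p.

Definition in_F1 (N : nat) (rho : 'M[R]_N) : Prop :=
  rho^T = rho /\ forall i, rho i i = 1.

Definition pairs (N : nat) : finType := {x : 'I_N * 'I_N | (x.1 < x.2)%N}.

Definition piv (N : nat) (rho : 'M[R]_N) : {ffun pairs N -> R} :=
  [ffun p => rho (val p).1 (val p).2].

Definition dotp (N : nat) (x y : {ffun pairs N -> R}) : R :=
  \sum_(p : pairs N) x p * y p.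

Definition in_UNstar (N : nat) (x : {ffun pairs N -> R}) : Prop :=
  exists rho : 'M[R]_N, in_UN rho /\ piv rho = x.

(* mu is an outer normal of a facet of the convex set S in F_N^* (of
   dimension D = #|pairs N|): mu <> 0, S lies in {<x,mu> <= o}, and the
   face S ∩ {<x,mu> = o} contains D affinely independent points, i.e. has
   affine dimension D - 1. *)
Definition facet_outer_normal (N : nat) (S : {ffun pairs N -> R} -> Prop)
    (mu : {ffun pairs N -> R}) : Prop :=
  mu != 0 /\
  exists o : R,
    (forall x, S x -> dotp x mu <= o) /\
    exists pts : 'I_#|pairs N| -> {ffun pairs N -> R},
      (forall k, S (pts k) /\ dotp (pts k) mu = o) /\
      (forall c : 'I_#|pairs N| -> R,
          \sum_k c k = 0 ->
          (forall q, \sum_k c k * pts k q = 0) ->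
          forall k, c k = 0).

Definition in_EN (N : nat) (e : 'I_N -> int) : Prop :=
  exists u : BN N, \sum_i signR (u i) * (e i)%:~R = 1.

Definition prodvec (N : nat) (e : 'I_N -> int) : {ffun pairs N -> R} :=
  [ffun p => ((e (val p).1) * (e (val p).2))%:~R].

Definition qform (N : nat) (rho : 'M[R]_N) (e : 'I_N -> int) : R :=
  \sum_i \sum_j rho i j * (e i)%:~R * (e j)%:~R.

End UnitFields.

(* Main.v *)
(* On the cube {-1,1}^N with 2 <= N <= 6, the cone of nonnegative functions
   f(u) = sum_ij A_ij u_i u_j is generated by the functions (e.u)^2 - 1 with e
   in E_N. It suffices that every nonzero f >= 0 admits such a generator whose
   support lies in the support of f: one then subtracts the largest admissible
   multiple and inducts on the size of the support. If f vanishes nowhere any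
   generator will do; otherwise switching signs moves a zero of f to the all-ones
   point, and the extreme rays of the cone of f >= 0 with f(1,...,1) = 0 (210 of
   them for N = 6) are computed by a verified double description method.
   Farkas' lemma turns the generation statement into the description of U_N.
   If mu is a facet normal with offset o, then o - <.,mu> is a nonnegative
   combination of generators; any generator that occurs vanishes on the facet,
   hence has the same hyperplane. *)
Require Import Defs.
From mathcomp Require Import all_boot all_order all_algebra.
From mathcomp Require Import boolp reals ring lra.
Set Implicit Arguments. Unset Strict Implicit. Unset Printing Implicit Defensive.
Import Order.TTheory GRing.Theory Num.Theory.
Local Open Scope ring_scope.

(** * The double description computation *)

Fixpoint words (n : nat) : seq bitseq :=
  if n is n'.+1 then map (cons false) (words n') ++ map (cons true) (words n')
  else [:: [::]].

Definition weight (x : bitseq) : nat := count id x.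

(* A bit word x encodes the sign vector with -1 at the bits of x; as f(u) = f(-u),
   the first bit may be taken false. A quadratic function vanishing at the zero
   word is determined by its values at the words of weight 1 and 2, and
   [lagrange] is the dual basis. *)
Definition base (N : nat) : seq bitseq :=
  [seq x <- map (cons false) (words N.-1) | 0 < weight x <= 2]%N.

(* The base words come first, and the order of the others is the one that keeps
   the intermediate cones small. *)
Definition points (N : nat) : seq bitseq :=
  base N ++ [seq x <- map (cons false) (words N.-1) | 2 < weight x]%N.

(** By inclusion-exclusion, f(x) is the sum of f over the pairs of bits of x plus (2 - |x|) times
    its sum over the single bits of x. *)
Definition lagrange (b x : bitseq) : int :=
  if all2 implb b x then (if weight b == 1%N then 2 - (weight x)%:Z else 1) else 0.

(** A function is stored as the list of its values at [points N]. The dual basis generates the cone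
    of functions nonnegative at the base points, where the double description starts. *)
Definition base_rays (N : nat) : seq (seq int) :=
  [seq [seq lagrange b x | x <- points N] | b <- base N].

Definition nonzero (z : int) : bool := if z is Posz 0 then false else true.
Definition positive (z : int) : bool := if z is Posz _.+1 then true else false.
Definition negative (z : int) : bool := if z is Negz _ then true else false.

(* Trailing [false] are removed so that the zero mask is [::]. *)
Fixpoint trim (s : bitseq) : bitseq :=
  if s is b :: s' then
    let t := trim s' in if ~~ b && nilp t then [::] else b :: t
  else [::].

(* The support of g among the first k points, most recent point first. *)
Definition support_mask (k : nat) (g : seq int) : bitseq :=
  trim (rev (map nonzero (take k g))).

Fixpoint submask (s t : bitseq) : bool :=
  match s, t with
  | [::], _ => true
  | b :: s', [::] => if b then false else submask s' [::]
  | b :: s', c :: t' => if b && ~~ c then false else submask s' t'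
  end.

Fixpoint ormask (s t : bitseq) : bitseq :=
  match s, t with
  | [::], _ => t
  | _, [::] => s
  | b :: s', c :: t' => (b || c) :: ormask s' t'
  end.

Definition tails (b : bool) (S : seq bitseq) : seq bitseq :=
  [seq behead s | s <- S & head false s == b].

(* Tests that each union of a mask of P and a mask of M contains a mask of Z,
   splitting the three lists on their first bit rather than running over P x M. *)
Fixpoint pair_cover (n : nat) (P M Z : seq bitseq) : bool :=
  if [|| nilp P, nilp M | has (@nilp bool) Z] then true
  else if n is n'.+1 then
    let P0 := tails false P in let P1 := tails true P in
    let M0 := tails false M in let M1 := tails true M in
    let Z0 := tails false Z in let Z01 := map behead Z in
    [&& pair_cover n' P0 M0 Z0, pair_cover n' P0 M1 Z01 & pair_cover n' P1 (map behead M) Z01]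
  else false.

(* The positive combination of p and m that vanishes at point k. *)
Definition combine (k : nat) (p m : seq int) : seq int :=
  let a := absz (nth 0 p k) in let b := absz (nth 0 m k) in
  let d := gcdn a b in
  [seq (b %/ d)%:Z * xy.1 + (a %/ d)%:Z * xy.2 | xy <- zip p m].

(* Two extreme rays span a 2-face iff no third ray has its support in the union
   of theirs; the weight test is a cheap necessary condition. Soundness does not
   depend on this choice, as [dd_step] checks its own output. *)
Definition adjacent (d k : nat) (masks : seq bitseq) (s t : bitseq) : bool :=
  let u := ormask s t in
  if (weight u + d <= k + 2)%N then count (submask^~ u) masks == 2%N else false.

Definition dd_step (d k : nat) (G : seq (seq int)) : bool * seq (seq int) :=
  let P := [seq g <- G | positive (nth 0 g k)] in
  let M := [seq g <- G | negative (nth 0 g k)] in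
  let Z := [seq g <- G | ~~ nonzero (nth 0 g k)] in
  let tag g := (g, support_mask k g) in
  let masks := map (support_mask k) G in
  let tP := map tag P in
  let tM := map tag M in
  let new := [seq combine k p.1 m.1 | p <- tP,
                m <- [seq m <- tM | adjacent d k masks p.2 m.2]] in
  let mZ := map (support_mask k) (Z ++ new) in
  ([&& pair_cover k (unzip2 tP) (unzip2 tM) mZ, ~~ has (@nilp bool) mZ &
     all (fun g => all (fun z => ~~ negative z) (take k g) &&
                   ~~ nonzero (nth 0 g k)) new],
   P ++ Z ++ new).

Fixpoint dd_run (d k n : nat) (G : seq (seq int)) : option (seq (seq int)) :=
  if n is n'.+1 then
    let: (ok, G') := dd_step d k G in
    if ok then dd_run d k.+1 n' G' else None
  else Some G.

Definition interpolates (B : seq (seq int)) (m : nat) (f : seq int) : bool :=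
  all (fun j => nth 0 f j == foldr (fun i z => nth 0 f i * nth 0 (nth [::] B i) j + z)
                              0 (iota 0 (size B)))
      (iota 0 m).

Definition sign (x : bitseq) (i : nat) : int := if nth false x i then -1 else 1.

Fixpoint vectors (n : nat) : seq (seq int) :=
  if n is n'.+1 then
    [seq a :: v | a <- [:: -2; -1; 0; 1; 2], v <- vectors n']
  else [:: [::]].

(** Up to trailing zeros and order, norms 3 and 5 give the triangle (1,1,-1) and pentagonal
    (1,1,1,-1,-1) inequalities, norm 9 gives (2,1,1,-1,-1,-1) and (-2,1,1,1,1,-1), and (2,-1) serves
    for N = 2. Further vectors passing the filter are harmless: sum 1 makes the slack vanish at the
    zero word. Norm 1 is left out because its slack vanishes identically. *)
Definition hypermetric_vectors (N : nat) : seq (seq int) :=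
  [seq e <- vectors N | (foldr +%R 0 e == 1) &&
     (foldr (fun z s => z * z + s) 0 e \in [:: 3; 5; 9])].

Definition slack (e : seq int) (x : bitseq) : int :=
  let s := foldr (fun i z => nth 0 e i * sign x i + z) 0 (iota 0 (size e)) in
  s * s - 1.

Definition generators_ok (N : nat) (pts : seq bitseq) (G : seq (seq int)) : bool :=
  let m := size pts in
  let S := [seq support_mask m (map (slack e) pts) | e <- hypermetric_vectors N] in
  [&& ~~ nilp S, ~~ has (@nilp bool) S &
      all (fun g => has (submask^~ (support_mask m g)) S) G].

(** The third test is made on the functions u_a u_b - 1 because they span the quadratic functions
    vanishing at the all-ones point. *)
Definition dd_check (N : nat) : bool :=
  let pts := points N in
  let B := base_rays N in
  let d := size B in
  [&& (d <= size pts)%N,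
      all (fun i => all (fun j => nth 0 (nth [::] B i) j == (i == j)%:Z) (iota 0 d))
          (iota 0 d),
      all (fun a => all (fun b =>
         interpolates B (size pts) [seq sign x a * sign x b - 1 | x <- pts])
         (iota 0 N)) (iota 0 N) &
      if dd_run d d (size pts - d) B is Some G then generators_ok N pts G else false].

(** * Generation by supports *)

Lemma seq_minimum (R : realFieldType) (I : eqType) (s : seq I) (g : I -> R) :
  s != [::] -> exists2 i, i \in s & {in s, forall j, g i <= g j}.
Proof.
elim: s => // a [|b s] IH _.
  by exists a => [|j]; rewrite inE // => /eqP ->.
have [i si mi] := IH isT.
case: (leP (g a) (g i)) => h; [exists a|exists i].
- exact: mem_head.
- by move=> j; rewrite inE => /orP[/eqP -> //|/mi]; apply: le_trans.
- by rewrite inE si orbT.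
- by move=> j; rewrite inE => /orP[/eqP ->|/mi //]; apply: ltW.
Qed.

Lemma ltn_count (I : eqType) (s : seq I) (a b : pred I) (i : I) :
  {in s, forall j, a j -> b j} -> i \in s -> b i -> ~~ a i ->
  (count a s < count b s)%N.
Proof.
move=> ab si bi ai; rewrite -[count b s]size_filter.
rewrite -(count_predC a (filter b s)) !count_filter.
have /eq_in_count -> : {in s, predI a b =1 a}.
  by move=> j sj /=; case: (boolP (a j)) => // /(ab j sj) ->.
rewrite -[X in (X < _)%N]addn0 ltn_add2l -has_count.
by apply/hasP; exists i => //=; rewrite ai.
Qed.

Section Support.
Variables (R : realFieldType) (I T : eqType) (J : seq I) (val : T -> I -> R).
Variables (L : (I -> R) -> Prop) (P : T -> Prop).

(** Weights are strictly positive, so a nonnegative generator that occurs has its support inside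
    that of f. *)
Definition conic (f : I -> R) :=
  exists s : seq (R * T), (forall p, p \in s -> 0 < p.1 /\ P p.2) /\
    {in J, forall i, f i = \sum_(p <- s) p.1 * val p.2 i}.

Hypothesis LB : forall f c t, L f -> P t -> L (fun i => f i - c * val t i).
Hypothesis val_ge0 : forall t, P t -> {in J, forall i, 0 <= val t i}.

(** With c the minimum of f / [val t] over the support of [val t], f - c * [val t] stays
    nonnegative, gains no support point and loses the minimizer. The lemma serves twice: for the
    rays at each double description step, and for the slack functions on the cube. *)
Lemma support_generation :
  (forall f, L f -> {in J, forall i, 0 <= f i} -> has (fun i => f i != 0) J ->
     exists2 t, P t & has (fun i => val t i != 0) J /\
        {in J, forall i, val t i != 0 -> f i != 0}) ->
  forall f, L f -> {in J, forall i, 0 <= f i} -> conic f.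
Proof.
move=> H f; have [n] := ubnP (count (fun i => f i != 0) J).
elim: n f => // n IH f; rewrite ltnS => cn Lf f0.
have [hf|/hasPn z] := boolP (has (fun i => f i != 0) J); last first.
  exists [::]; split=> // i /z; rewrite negbK => /eqP ->.
  by rewrite big_nil.
have [t Pt [/hasP[i1 Ji1 vi1] st]] := H f Lf f0 hf.
have [|i0] := @seq_minimum R I [seq i <- J | val t i != 0] (fun i => f i / val t i).
  by rewrite -has_filter; apply/hasP; exists i1.
rewrite mem_filter => /andP[vi0 Ji0] mi0.
have vp0 : 0 < val t i0 by rewrite lt0r vi0 val_ge0.
have fp0 : 0 < f i0 by rewrite lt0r st ?f0.
pose c := f i0 / val t i0.
have c0 : 0 < c by rewrite divr_gt0.
pose f' := fun i => f i - c * val t i.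
have f'0 : {in J, forall i, 0 <= f' i}.
  move=> i Ji; rewrite /f' subr_ge0; have [->|vi] := eqVneq (val t i) 0.
    by rewrite mulr0 f0.
  rewrite -ler_pdivlMr; last by rewrite lt0r vi val_ge0.
  by apply: mi0; rewrite mem_filter vi.
have [|s [sP sE]] := IH f' _ (LB c Lf Pt) f'0.
  apply: leq_trans cn; apply: (@ltn_count _ _ _ _ i0) => //=.
  - move=> i Ji /=; apply: contraNneq => fi.
    rewrite /f' fi sub0r oppr_eq0 mulf_eq0; apply/orP; right.
    by apply: contraT => vi; have := st i Ji vi; rewrite fi eqxx.
  - by rewrite gt_eqF.
  - by rewrite negbK /f' /c divfK ?subrr.
exists ((c, t) :: s); split=> [p|i Ji].
  by rewrite inE => /orP[/eqP -> //|/sP].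
by rewrite big_cons -sE // /f' addrC subrK.
Qed.
End Support.

(** * Integer sign tests and support masks *)

Lemma nonzeroE (z : int) : nonzero z = (z != 0).
Proof. by case: z => [[|n]|n]. Qed.

Lemma positiveE (z : int) : positive z = (0 < z).
Proof. by case: z => [[|n]|n]. Qed.

Lemma negativeE (z : int) : negative z = (z < 0).
Proof. by case: z => [[|n]|n]. Qed.

Lemma nth_trim (s : bitseq) (i : nat) : nth false (trim s) i = nth false s i.
Proof.
elim: s i => //= b s IH i.
case: ifP => [/andP[/negbTE -> /nilP ts]|_]; last by case: i => //= i.
by case: i => //= i; rewrite -IH ts nth_nil.
Qed.

Lemma trim_nil (s : bitseq) : nilp (trim s) = ~~ has id s.
Proof.
elim: s => //= -[] s IH //=.
by rewrite -IH; case: (nilp (trim s)).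
Qed.

Lemma nth_mask (k : nat) (g : seq int) (j : nat) : (k <= size g)%N -> (j < k)%N ->
  nth false (support_mask k g) (k.-1 - j) = (nth 0 g j != 0).
Proof.
move=> kg jk; rewrite /support_mask nth_trim.
have sz : size (map nonzero (take k g)) = k by rewrite size_map size_takel.
have k1 : (k.-1 - j < k)%N by apply: leq_ltn_trans (leq_subr _ _) _; case: k jk {kg sz}.
rewrite nth_rev sz // -nonzeroE -(nth_take _ jk) -(nth_map 0 false) ?size_takel //.
by congr nth; case: k jk {kg sz k1} => //= k jk; rewrite subSS subKn.
Qed.

Lemma mask_nil (k : nat) (g : seq int) : (k <= size g)%N ->
  ~~ nilp (support_mask k g) -> exists2 j, (j < k)%N & nth 0 g j != 0.
Proof.
move=> kg; rewrite /support_mask trim_nil negbK has_rev has_map => /(has_nthP 0)[j].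
rewrite size_takel // => jk /=; rewrite nth_take // nonzeroE; by exists j.
Qed.

Lemma submask_nth (s t : bitseq) (i : nat) :
  submask s t -> nth false s i -> nth false t i.
Proof.
elim: s t i => [|b s IH] t i; first by rewrite nth_nil.
case: t => [|c t] /=; case: i => [|i] //=; case: b => //=.
- by move=> /IH h /h; rewrite nth_nil.
- by case: c.
- by case: c => //= /IH h /h.
- by move=> /IH h /h.
Qed.

Lemma tails_mem (b : bool) (S : seq bitseq) (s : bitseq) :
  s \in S -> head false s = b -> behead s \in tails b S.
Proof. by move=> sS sb; apply: map_f; rewrite mem_filter sb eqxx. Qed.

(** The first bit of z is constrained only when p and m both start with false, so only that branch
    restricts Z. An exhausted mask reads as false throughout, in agreement with [trim]. *)
Lemma pair_cover_sound (n : nat) (P M Z : seq bitseq) (p m : bitseq) :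
  pair_cover n P M Z -> p \in P -> m \in M ->
  exists2 z, z \in Z & forall i, nth false z i -> nth false p i || nth false m i.
Proof.
elim: n P M Z p m => [|n IH] P M Z p m /=;
  (case: ifP => [/or3P[/nilP ->|/nilP ->|/hasP[z zZ /nilP z0]] //|_];
   first by move=> _ _ _; exists z => // i; rewrite z0 nth_nil) => //.
move=> /and3P[c00 c01 c1] pP mM.
have lift z : z \in map behead Z ->
    (head false p || head false m) ->
    (forall i, nth false z i -> nth false (behead p) i || nth false (behead m) i) ->
    exists2 z, z \in Z & forall i, nth false z i -> nth false p i || nth false m i.
  move=> /mapP[z' z'Z ->] pm h; exists z' => // -[_|i]; first by rewrite !nth0.
  by rewrite -!nth_behead; apply: h.
case ep: (head false p).
  have [//||z zZ h] := IH _ _ _ (behead p) (behead m) c1.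
  - exact: tails_mem.
  - exact: map_f.
  by apply: (lift z zZ _ h); rewrite ep.
case em: (head false m).
  have [//||z zZ h] := IH _ _ _ (behead p) (behead m) c01.
  - exact: tails_mem.
  - exact: tails_mem.
  by apply: (lift z zZ _ h); rewrite em orbT.
have [//||z /mapP[z']] := IH _ _ _ (behead p) (behead m) c00; try exact: tails_mem.
rewrite mem_filter => /andP[/eqP z'0 z'Z] -> h; exists z' => // -[|i].
  by rewrite nth0 z'0.
by rewrite -!nth_behead; apply: h.
Qed.

(** * Soundness of the double description step *)

Lemma sumr_seq_gt0 (R : realFieldType) (I : eqType) (s : seq I) (F : I -> R) (i : I) :
  {in s, forall j, 0 <= F j} -> i \in s -> 0 < F i -> 0 < \sum_(j <- s) F j.
Proof.
move=> F0 si Fi; rewrite (big_rem i) //= ltr_pwDl // big_seq.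
by apply: sumr_ge0 => j /mem_rem /F0.
Qed.

Section DoubleDescription.
Variables (R : realFieldType) (B : seq (seq int)) (m : nat).

Definition ray (g : seq int) (j : nat) : R := (nth 0 g j)%:~R.

(** For B dual to the first points this is the linear span of B, the coefficients being the values
    of f there. It plays the role of [L] in [support_generation]. *)
Definition interpolated (f : nat -> R) :=
  forall j, (j < m)%N -> f j = \sum_(i <- iota 0 (size B)) f i * ray (nth [::] B i) j.

Lemma interpolatedD (f g : nat -> R) (a b : R) :
  interpolated f -> interpolated g -> interpolated (fun j => a * f j + b * g j).
Proof.
move=> Lf Lg j jm /=; rewrite Lf // Lg // !mulr_sumr -big_split /=.
by apply: eq_bigr => i _; rewrite mulrDl !mulrA.
Qed.

Lemma interpolated_ext (f g : nat -> R) : (size B <= m)%N ->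
  (forall j, (j < m)%N -> f j = g j) -> interpolated f -> interpolated g.
Proof.
move=> Bm fg Lf j jm; rewrite -fg // Lf //; apply: eq_big_seq => i.
by rewrite mem_iota /= add0n => iB; rewrite fg // (leq_trans iB).
Qed.

Definition dd_invariant (k : nat) (G : seq (seq int)) :=
  [/\ forall g, g \in G -> size g = m /\ interpolated (ray g),
      forall g, g \in G -> forall j, (j < k)%N -> 0 <= nth 0 g j
    & forall f, interpolated f -> (forall j, (j < k)%N -> 0 <= f j) ->
        conic (iota 0 k) ray (fun g => g \in G) f].

(** Since k is at least the number of base points, the two sides agree at the base points; both are
    interpolated from there, so they agree at all m points. *)
Lemma conic_extend (k : nat) (G : seq (seq int)) (f : nat -> R) :
  (size B <= k <= m)%N -> (forall g, g \in G -> interpolated (ray g)) ->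
  interpolated f -> conic (iota 0 k) ray (fun g => g \in G) f ->
  conic (iota 0 m) ray (fun g => g \in G) f.
Proof.
move=> /andP[Bk km] LG Lf [s [sP sE]]; exists s; split=> // j.
rewrite mem_iota /= add0n => jm; rewrite Lf //.
have -> : \sum_(p <- s) p.1 * ray p.2 j =
    \sum_(p <- s) \sum_(i <- iota 0 (size B)) p.1 * ray p.2 i * ray (nth [::] B i) j.
  apply: eq_big_seq => p /sP[_ /LG ->] //; rewrite mulr_sumr.
  by apply: eq_bigr => i _; rewrite mulrA.
rewrite exchange_big; apply: eq_big_seq => i; rewrite mem_iota /= add0n => iB.
by rewrite -mulr_suml sE // mem_iota /= add0n (leq_trans iB).
Qed.

Hypothesis Bm : (size B <= m)%N.

Lemma dd_invariant_base :
  (forall i, (i < size B)%N -> size (nth [::] B i) = m) ->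
  (forall i j, (i < size B)%N -> (j < size B)%N ->
     nth 0 (nth [::] B i) j = (i == j)%:Z) ->
  dd_invariant (size B) B.
Proof.
move=> sz del; split=> [g|g|f Lf f0].
- move=> /(nthP [::])[i iB <-]; split; first exact: sz.
  move=> j jm; rewrite (bigD1_seq i) ?iota_uniq ?mem_iota //= big1_seq.
    by rewrite {2}/ray (del i i) // eqxx mul1r addr0.
  move=> l /andP[li]; rewrite mem_iota /= add0n => lB.
  by rewrite {1}/ray (del i l) // eq_sym (negbTE li) mul0r.
- by move=> /(nthP [::])[i iB <-] j jB; rewrite del.
(* The coefficients are the base values of f; zeros are dropped because [conic] asks for positive
   weights. *)
exists [seq (f i, nth [::] B i) | i <- iota 0 (size B) & f i != 0]; split.
  move=> p /mapP[i]; rewrite mem_filter mem_iota /= add0n => /andP[fi iB] ->.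
  by rewrite lt0r fi f0 //= mem_nth.
move=> j; rewrite mem_iota /= add0n => jB.
rewrite {1}Lf ?(leq_trans jB) // big_map big_filter [RHS]big_mkcond /=.
by apply: eq_bigr => i _; case: eqP => // ->; rewrite mul0r.
Qed.

Lemma combine_ray (k : nat) (p q : seq int) : size p = m -> size q = m ->
  size (combine k p q) = m /\ exists a b : R,
    forall j, (j < m)%N -> ray (combine k p q) j = a * ray p j + b * ray q j.
Proof.
move=> sp sq; have sz : size (zip p q) = m by rewrite size_zip sp sq minnn.
rewrite /combine; set a := (_ %/ _)%N; set b := (_ %/ _)%N.
split; first by rewrite size_map.
exists a%:R, b%:R => j jm; rewrite /ray (nth_map (0, 0)) ?sz // nth_zip ?sp ?sq //=.
by rewrite intrD !intrM.
Qed.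

(** By [support_generation], it suffices to find in G' a nonzero ray supported inside the support of
    f. It is read off from a decomposition of f over the old rays, according to the signs of their
    values at point k. *)
Lemma dd_step_sound (d k : nat) (G G' : seq (seq int)) :
  (size B <= k < m)%N -> dd_step d k G = (true, G') ->
  dd_invariant k G -> dd_invariant k.+1 G'.
Proof.
move=> /andP[Bk km]; rewrite /dd_step.
set P := [seq g <- G | positive _]; set M := [seq g <- G | negative _].
set Z := [seq g <- G | ~~ nonzero _]; set new := flatten _ => -[].
move=> /and3P[cov nil newok] <- [szL Gge0 gen] {G'}.
have newP g : g \in new -> exists2 p, p \in G & exists2 q, q \in G & g = combine k p q.
  case/allpairsPdep => -[p mp] [[q mq]] [/mapP[p' +] [-> _]].
  rewrite mem_filter => /andP[_ pG]; rewrite mem_filter => /andP[_ /mapP[q']].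
  rewrite mem_filter => /andP[_ qG] [-> _] ->; by exists p' => //; exists q'.
have szL' g : g \in P ++ Z ++ new -> size g = m /\ interpolated (ray g).
  rewrite !mem_cat !mem_filter => /or3P[/andP[_]|/andP[_]|/newP[p pG [q qG ->]]].
  - exact: szL.
  - exact: szL.
  have [[sp Lp] [sq Lq]] := (szL p pG, szL q qG).
  have [-> [a [b ab]]] := combine_ray k sp sq; split=> //.
  apply: interpolated_ext (interpolatedD a b Lp Lq) => // j jm; by rewrite ab.
have Zk g : g \in Z ++ new -> nth 0 g k = 0.
  rewrite mem_cat mem_filter nonzeroE negbK => /orP[/andP[/eqP //]|gn].
  by have /allP/(_ g gn)/andP[_] := newok; rewrite nonzeroE negbK => /eqP.
have G'ge0 g : g \in P ++ Z ++ new -> forall j, (j < k.+1)%N -> 0 <= nth 0 g j.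
  move=> gG' j; rewrite ltnS leq_eqVlt => /orP[/eqP ->|jk].
    move: gG'; rewrite mem_cat => /orP[|/Zk -> //].
    by rewrite mem_filter positiveE => /andP[/ltW].
  move: gG'; rewrite mem_cat => /orP[|].
    by rewrite mem_filter => /andP[_ /Gge0]; apply.
  rewrite mem_cat => /orP[|gn].
    by rewrite mem_filter => /andP[_ /Gge0]; apply.
  have [sg _] : size g = m /\ interpolated (ray g) by apply: szL'; rewrite !mem_cat gn !orbT.
  have /allP/(_ g gn)/andP[/allP/(_ (nth 0 g j))] := newok.
  rewrite negativeE -leNgt => + _; apply.
  by rewrite -(nth_take _ jk) mem_nth // size_takel // sg ltnW.
split=> // f Lf f0.
apply: (@support_generation R nat (seq int) (iota 0 k.+1) ray interpolated) => //.
- move=> h c t Lh /szL'[_ Lt].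
  apply: interpolated_ext (interpolatedD 1 (- c) Lh Lt) => // j _.
  by rewrite mul1r mulNr.
- move=> g gG' j; rewrite mem_iota /= add0n => jk.
  by rewrite ler0z G'ge0.
- move=> {}f {}Lf {}f0 /hasP[j0]; rewrite mem_iota /= add0n => j0k fj0.
  have fge0 j : (j < k.+1)%N -> 0 <= f j by move=> jk; apply: f0; rewrite mem_iota.
  have [s [sP sE]] : conic (iota 0 m) ray (fun g => g \in G) f.
    apply: (@conic_extend k) => //; first by rewrite Bk ltnW.
      by move=> g /szL[].
    by apply: gen => // j jk; apply: fge0; rewrite ltnW.
  have {}sE j : (j < m)%N -> f j = \sum_(p <- s) p.1 * ray p.2 j.
    by move=> jm; apply: sE; rewrite mem_iota.
  have term_ge0 j : (j < k)%N -> forall p, p \in s -> 0 <= p.1 * ray p.2 j.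
    by move=> jk p /sP[/ltW p0 /Gge0/(_ j jk) g0]; rewrite mulr_ge0 // ler0z.
  have supp j : (forall p, p \in s -> 0 <= p.1 * ray p.2 j) -> (j < m)%N ->
      forall p, p \in s -> nth 0 p.2 j != 0 -> f j != 0.
    move=> t0 jm p ps gj; rewrite sE // gt_eqF //.
    apply: (sumr_seq_gt0 t0 ps); rewrite lt0r t0 // andbT mulf_neq0 //.
      by rewrite gt_eqF //; have [] := sP p ps.
    by rewrite intr_eq0.
  have szG g : g \in G -> (k <= size g)%N by move=> /szL[-> _]; rewrite ltnW.
  have nonzero_support g : g \in P ++ Z ++ new ->
      has (fun i => ray g i != 0) (iota 0 k.+1).
    move=> gG'; suff [j jk gj] : exists2 j, (j < k.+1)%N & nth 0 g j != 0.
      by apply/hasP; exists j; rewrite ?mem_iota ?intr_eq0.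
    have [sg _] := szL' g gG'.
    move: gG'; rewrite mem_cat => /orP[|gn].
      by rewrite mem_filter positiveE => /andP[/lt0r_neq0 gk _]; exists k.
    have [||j jk gj] := @mask_nil k g; first by rewrite sg ltnW.
      by apply: contra nil => ng; apply/hasP; exists (support_mask k g) => //; apply: map_f.
    by exists j => //; rewrite ltnW.
  have [/hasP[q qs qk]|/hasPn noneg] := boolP (has (fun p => nth 0 p.2 k < 0) s).
    (* With both signs present, the cover test yields a ray vanishing at k whose support before k
       lies in the union of those of p and q, hence in that of f. *)
    have [/hasP[p ps pk]|/hasPn nopos] := boolP (has (fun p => 0 < nth 0 p.2 k) s).
      have [[_ pG] [_ qG]] := (sP p ps, sP q qs).
      have [||z] := pair_cover_sound cov (p := support_mask k p.2) (m := support_mask k q.2).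
      - rewrite /unzip2 -map_comp; apply/mapP; exists p.2 => //.
        by rewrite mem_filter positiveE pk.
      - rewrite /unzip2 -map_comp; apply/mapP; exists q.2 => //.
        by rewrite mem_filter negativeE qk.
      move=> /mapP[g gZ ->] gs; have gG' : g \in P ++ Z ++ new by rewrite mem_cat gZ orbT.
      exists g => //; split; first exact: nonzero_support.
      move=> j; rewrite -[_ :: _]/(iota 0 k.+1) mem_iota /= add0n ltnS leq_eqVlt intr_eq0 => /orP[/eqP ->|jk].
        by rewrite Zk ?eqxx.
      have [sg _] := szL' g gG'.
      rewrite -(@nth_mask k) ?sg ?(ltnW km) // => /gs.
      rewrite !nth_mask ?szG // => /orP[].
        by apply: (supp j (term_ge0 j jk)); rewrite ?(ltn_trans jk).
      by apply: (supp j (term_ge0 j jk)); rewrite ?(ltn_trans jk).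
    (* A negative value without a positive one would make f negative at k. *)
    suff : f k < 0 by rewrite ltNge fge0.
    rewrite sE // -oppr_gt0 -sumrN; apply: (sumr_seq_gt0 _ qs) => [p ps|].
      rewrite oppr_ge0 mulr_ge0_le0 // ?(ltW (proj1 (sP p ps))) // lerz0.
      by rewrite leNgt nopos.
    by rewrite oppr_gt0 pmulr_rlt0 ?ltrz0 //; have [] := sP q qs.
  (* Without negative values every ray of the decomposition survives in G', and the first one will
     do. *)
  case: s sP sE term_ge0 supp noneg => [|p s] sP sE term_ge0 supp noneg.
    by move: fj0; rewrite sE ?big_nil ?eqxx // (leq_trans j0k).
  have ps : p \in p :: s := mem_head _ _.
  have pG' : p.2 \in P ++ Z ++ new.
    rewrite !mem_cat !mem_filter positiveE nonzeroE negbK (proj2 (sP p ps)) !andbT.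
    by have := noneg p ps; rewrite -leNgt le0r => /orP[->|->]; rewrite ?orbT.
  exists p.2 => //; split; first exact: nonzero_support.
  move=> j; rewrite -[_ :: _]/(iota 0 k.+1) mem_iota /= add0n ltnS leq_eqVlt intr_eq0 => /orP[/eqP ->|jk].
    apply: supp => // q qs; rewrite mulr_ge0 ?(ltW (proj1 (sP q qs))) // ler0z.
    by rewrite leNgt noneg.
  by apply: supp => //; [exact: term_ge0|exact: ltn_trans km].
- by move=> j; rewrite mem_iota; apply: f0.
Qed.
End DoubleDescription.

(** * Quadratic functions on the cube *)

Lemma dd_runS (d k n : nat) (G : seq (seq int)) :
  dd_run d k n.+1 G =
    let: (ok, G') := dd_step d k G in if ok then dd_run d k.+1 n G' else None.
Proof. by []. Qed.

Lemma dd_run_sound (R : realFieldType) (B : seq (seq int)) (m d k n : nat)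
    (G G' : seq (seq int)) :
  (size B <= k)%N -> (k + n)%N = m -> dd_run d k n G = Some G' ->
  dd_invariant R B m k G -> dd_invariant R B m m G'.
Proof.
elim: n k G => [|n IH] k G Bk; first by rewrite addn0 => <- [->].
move=> knm; rewrite dd_runS; case E: (dd_step d k G) => [[] G1] // run inv.
have km : (k < m)%N by rewrite -knm addnS ltnS leq_addr.
apply: (IH k.+1 G1 (leqW Bk) _ run); first by rewrite addSnnS.
by apply: dd_step_sound E inv; rewrite ?(leq_trans Bk (ltnW km)) ?Bk.
Qed.

Lemma mem_words (n : nat) (s : bitseq) : (s \in words n) = (size s == n).
Proof.
elim: n s => [|n IH] [|b s] //=.
  by rewrite mem_cat; apply/orP => -[] /mapP[].
rewrite mem_cat eqSS -IH; apply/orP/idP => [[] /mapP[t tw [_ ->]] //|sw].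
by case: b; [right|left]; apply: map_f.
Qed.

Lemma mem_points (N : nat) (s : bitseq) : size s = N.-1 -> has id s ->
  false :: s \in points N.
Proof.
move=> sN hs; have w0 : (0 < weight (false :: s))%N by rewrite /weight -has_count.
rewrite /points /base mem_cat !mem_filter w0 /= map_f ?mem_words ?sN //.
by rewrite !andbT; case: leqP.
Qed.

Lemma odd_absz (z : int) : odd (absz z) = ~~ (2 %| z)%Z.
Proof. by rewrite dvdzE dvdn2 negbK. Qed.

Section Quadratic.
Variables (R : realType) (N : nat).
Implicit Types (u : BN N) (e : {ffun 'I_N -> int}) (A : 'M[R]_N).

Local Notation sg := (signR R).

Lemma signR_sqr b : sg b * sg b = 1.
Proof. by case: b; rewrite /signR ?mulrNN mulr1. Qed.

Lemma signR_neg b : sg (~~ b) = - sg b.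
Proof. by case: b; rewrite /signR ?opprK. Qed.

Definition quad A u : R := \sum_i \sum_j A i j * sg (u i) * sg (u j).

Definition slackR e u : R := (\sum_i sg (u i) * (e i)%:~R) ^+ 2 - 1.

Lemma sum_signR_int (e : 'I_N -> int) u :
  \sum_i sg (u i) * (e i)%:~R = (\sum_i (if u i then e i else - e i))%:~R.
Proof.
rewrite rmorph_sum; apply: eq_bigr => i _.
by case: (u i); rewrite /signR ?mul1r ?mulN1r ?rmorphN.
Qed.

(** Changing signs alters the sum by an even number. An odd signed sum is nonzero, so its square is
    at least 1; averaging over the law gives (ii). *)
Lemma odd_signed_sum (e : 'I_N -> int) u :
  odd (absz (\sum_i (if u i then e i else - e i))) = odd (absz (\sum_i e i)).
Proof.
rewrite !odd_absz; congr negb.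
have -> : \sum_i (if u i then e i else - e i) =
    \sum_i e i + 2 * \sum_i (if u i then 0 else - e i).
  rewrite mulr_sumr -big_split /=; apply: eq_bigr => i _; case: (u i).
    by rewrite mulr0 addr0.
  by rewrite mulrN mulr_natl mulr2n opprD addNKr.
by rewrite rpredDr // dvdz_mulr.
Qed.

Lemma in_EN_odd (e : 'I_N -> int) : in_EN R e -> odd (absz (\sum_i e i)).
Proof.
case=> u; rewrite sum_signR_int => /eqP; rewrite -[1]/((1 : int)%:~R) eqr_int => /eqP E.
by rewrite -(odd_signed_sum e u) E.
Qed.

Lemma signed_sum_sqr_ge1 (e : 'I_N -> int) u : odd (absz (\sum_i e i)) ->
  1 <= (\sum_i sg (u i) * (e i)%:~R) ^+ 2 :> R.
Proof.
rewrite -(odd_signed_sum e u) sum_signR_int; set z := \sum_i _ => oz.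
rewrite -rmorphXn /= ler1z -gtz0_ge1 exprn_even_gt0 //.
by apply: contraTneq oz => ->.
Qed.

Lemma slackR_ge0 e u : in_EN R e -> 0 <= slackR e u.
Proof. by move=> /in_EN_odd oe; rewrite subr_ge0 signed_sum_sqr_ge1. Qed.

(** As u_i^2 = 1, spreading the constant 1 over the diagonal turns the slack into a homogeneous
    quadratic function; pairing with a matrix of unit diagonal recovers the same constant. *)
Definition slack_mx e : 'M[R]_N :=
  \matrix_(i, j) ((e i)%:~R * (e j)%:~R - (i == j)%:R / N%:R).

Lemma quad_slack e u : (0 < N)%N -> quad (slack_mx e) u = slackR e u.
Proof.
move=> N0; rewrite /slackR expr2 mulr_suml.
transitivity (\sum_i (sg (u i) * (e i)%:~R * \sum_j sg (u j) * (e j)%:~R - N%:R^-1)).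
  apply: eq_bigr => i _; rewrite mulr_sumr.
  transitivity (\sum_j (sg (u i) * (e i)%:~R * (sg (u j) * (e j)%:~R)
                  - (if j == i then N%:R^-1 else 0))).
    apply: eq_bigr => j _; rewrite mxE -mulrA mulrBl; congr (_ - _).
      by rewrite mulrACA [_ * sg (u i)]mulrC [_ * sg (u j)]mulrC.
    rewrite [j == i]eq_sym; case: eqP => [->|_]; last by rewrite !mul0r.
    by rewrite signR_sqr mulr1 mul1r.
  by rewrite sumrB -big_mkcond big_pred1_eq.
rewrite sumrB sumr_const card_ord -[_ *+ N]mulr_natl divff //.
by rewrite pnatr_eq0 -lt0n.
Qed.

Lemma quadB A A' (c : R) u : quad (A - c *: A') u = quad A u - c * quad A' u.
Proof.
rewrite /quad mulr_sumr -sumrB; apply: eq_bigr => i _.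
rewrite mulr_sumr -sumrB; apply: eq_bigr => j _.
by rewrite !mxE !mulrBl !mulrA.
Qed.

Definition switch u (x : bitseq) : BN N := [ffun i => u i (+) nth false x i].

Lemma signR_switch u x i : sg (switch u x i) = sg (u i) * (sign x i)%:~R.
Proof.
rewrite ffunE /sign; case: nth; rewrite ?addbT ?addbF ?mulr1 // signR_neg.
by rewrite mulrN1.
Qed.

Lemma quad_opp A u u' : (forall i, u' i = ~~ u i) -> quad A u' = quad A u.
Proof.
move=> uu'; apply: eq_bigr => i _; apply: eq_bigr => j _.
by rewrite !uu' !signR_neg !(mulrN, mulNr) opprK.
Qed.

Lemma slackR_opp e u u' : (forall i, u' i = ~~ u i) -> slackR e u' = slackR e u.
Proof.
move=> uu'; rewrite /slackR -[in RHS]sqrrN -sumrN; congr (_ ^+ 2 - 1).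
by apply: eq_bigr => i _; rewrite uu' signR_neg mulNr.
Qed.

(** The word is the coordinatewise difference of u0 and u, complemented if its first bit is true. *)
Lemma switch_surj u0 u : (0 < N)%N -> exists2 x, x \in [:: nseq N false] ++ points N &
  (forall i, u i = switch u0 x i) \/ (forall i, u i = ~~ switch u0 x i).
Proof.
move=> N0; pose c := u0 (Ordinal N0) (+) u (Ordinal N0).
(* The default is never reached, since [mkseq] only takes k < N. *)
pose w := mkseq (fun k => if insub k is Some i then u0 i (+) u i (+) c else false) N.
have wE i : nth false w (val i) = u0 i (+) u i (+) c.
  by rewrite nth_mkseq ?ltn_ord // (valK i).
have sw : size w = N by rewrite size_mkseq.
have w0 : nth false w 0 = false.
  by have := wE (Ordinal N0); rewrite /= => ->; rewrite addbb.
exists w.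
  case: w sw w0 {wE} => [|b s] /=; first by move=> E; have := N0; rewrite -{1}E.
  move=> sN b0; rewrite b0 inE; have [hs|/hasPn hs] := boolP (has id s).
    by rewrite mem_points ?orbT // -sN.
  suff -> : s = nseq N.-1 false by rewrite -[in X in _ == X](prednK N0) eqxx.
  by rewrite -sN /=; apply/all_pred1P/allP => -[] // /hs.
have sE i : switch u0 w i = u i (+) c by rewrite ffunE wE !addbA addbb addFb.
case: (boolP c) => [ct|/negbTE cf]; [right|left] => i; rewrite sE.
  by rewrite ct addbT negbK.
by rewrite cf addbF.
Qed.

End Quadratic.

(** * Slack functions generate the nonnegative quadratic functions *)

Lemma foldr_sum (V : nmodType) (I : Type) (s : seq I) (F : I -> V) :
  foldr (fun i z => F i + z) 0 s = \sum_(i <- s) F i.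
Proof. by elim: s => [|i s IH] /=; rewrite ?big_nil // big_cons IH. Qed.

Lemma sum_iota (V : nmodType) (n : nat) (F : nat -> V) :
  \sum_(i <- iota 0 n) F i = \sum_(i < n) F i.
Proof. by rewrite -{1}[n]subn0 big_mkord. Qed.

Lemma size_vectors (n : nat) (e : seq int) : e \in vectors n -> size e = n.
Proof.
elim: n e => [|n IH] e; first by rewrite inE => /eqP ->.
by move=> /allpairsP[[a v] [_ /IH <- ->]].
Qed.

Lemma hypermetric_vectorsP (N : nat) (e : seq int) : e \in hypermetric_vectors N ->
  size e = N /\ \sum_(i < N) nth 0 e i = 1.
Proof.
rewrite mem_filter => /andP[/andP[/eqP + _] /size_vectors sz].
rewrite (foldr_sum e id) (big_nth 0) big_mkord sz; by split.
Qed.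

Lemma interpolates_sound (R : realFieldType) (B : seq (seq int)) (m : nat)
    (f : seq int) : interpolates B m f -> interpolated B m (ray R f).
Proof.
move=> /allP h j jm; have := h j; rewrite mem_iota => /(_ jm)/eqP.
rewrite (foldr_sum _ (fun i => nth 0 f i * nth 0 (nth [::] B i) j)) {1}/ray => ->.
by rewrite rmorph_sum; apply: eq_bigr => i _; rewrite rmorphM.
Qed.

Section Generators.
Variables (R : realType) (N : nat).
Hypothesis N0 : (0 < N)%N.
Hypothesis check : dd_check N.

Local Notation sg := (signR R).
Local Notation pts := (points N).
Local Notation m := (size (points N)).

(** Moves the zero of the slack of z from the all-ones point to u. *)
Definition switch_vector (u : BN N) (z : seq int) : {ffun 'I_N -> int} :=
  [ffun i : 'I_N => if u i then nth 0 z i else - nth 0 z i].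

Lemma slackR_switch (u : BN N) (z : seq int) (x : bitseq) : size z = N ->
  slackR R (switch_vector u z) (switch u x) = (slack z x)%:~R.
Proof.
move=> sz; rewrite /slack (foldr_sum _ (fun i => nth 0 z i * sign x i)) sz sum_iota.
rewrite rmorphB rmorphM /= /slackR expr2; congr (_ * _ - 1).
  rewrite rmorph_sum; apply: eq_bigr => i _; rewrite signR_switch ffunE rmorphM.
  by case: (u i); rewrite /signR ?mul1r ?mulN1r ?rmorphN ?mulrNN mulrC.
rewrite rmorph_sum; apply: eq_bigr => i _; rewrite signR_switch ffunE rmorphM.
by case: (u i); rewrite /signR ?mul1r ?mulN1r ?rmorphN ?mulrNN mulrC.
Qed.

Lemma in_EN_switch (u : BN N) (z : seq int) :
  \sum_(i < N) nth 0 z i = 1 -> in_EN R (switch_vector u z).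
Proof.
move=> sz; exists u; rewrite sum_signR_int.
under eq_bigr do rewrite ffunE; rewrite -[RHS]/((1 : int)%:~R) -sz; congr _%:~R.
by apply: eq_bigr => i _; case: (u i); rewrite ?opprK.
Qed.

Lemma sign_nseq (i : nat) : sign (nseq N false) i = 1.
Proof. by rewrite /sign nth_nseq if_same. Qed.

Lemma slack_nseq (z : seq int) : size z = N -> \sum_(i < N) nth 0 z i = 1 ->
  slack z (nseq N false) = 0.
Proof.
move=> sz z1; rewrite /slack (foldr_sum _ (fun i => nth 0 z i * sign _ i)) sz sum_iota.
by under eq_bigr do rewrite sign_nseq mulr1; rewrite z1 mulr1 subrr.
Qed.

Lemma dd_generators : exists G : seq (seq int),
  [/\ forall g, g \in G -> size g = m /\ forall j, (j < m)%N -> 0 <= nth 0 g j,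
      forall f : nat -> R, interpolated (base_rays N) m f ->
        (forall j, (j < m)%N -> 0 <= f j) ->
        conic (iota 0 m) (ray R) (fun g => g \in G) f
    & generators_ok N pts G].
Proof.
move: check => /and4P[Bm /allP del _]; case E: (dd_run _ _ _ _) => [G|] // ok.
exists G; have [szG G0 gen] : dd_invariant R (base_rays N) m m G; last first.
  by split=> // g gG; split; [case: (szG g gG)|exact: G0].
apply: (dd_run_sound _ _ E) => //; first exact: subnKC.
apply: dd_invariant_base => // [i|i j] iB.
  by rewrite (nth_map [::]) ?size_map //; rewrite size_map in iB.
move=> jB; have := del i; rewrite mem_iota => /(_ iB)/allP/(_ j).
by rewrite mem_iota => /(_ jB)/eqP.
Qed.

(** Subtracting the zero value at u0 writes the function as a combination of the products of two
    signs minus 1, whose interpolation has been checked. *)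
Lemma quad_switch_interpolated (A : 'M[R]_N) (u0 : BN N) : quad A u0 = 0 ->
  interpolated (base_rays N) m (fun j => quad A (switch u0 (nth [::] pts j))).
Proof.
move=> A0; pose c (i j : 'I_N) := A i j * sg (u0 i) * sg (u0 j).
pose mono (i j : 'I_N) := [seq sign x i * sign x j - 1 | x <- pts].
have E k : (k < m)%N ->
    quad A (switch u0 (nth [::] pts k)) = \sum_i \sum_j c i j * ray R (mono i j) k.
  move=> km; rewrite -[LHS]subr0 -[X in _ - X = _]A0 /quad -sumrB; apply: eq_bigr => i _.
  rewrite -sumrB; apply: eq_bigr => j _; rewrite /ray (nth_map [::]) //.
  rewrite !signR_switch rmorphB rmorphM /= mulrBr mulr1 /c; congr (_ - _).
  by rewrite mulrA [RHS]mulrACA !mulrA.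
have [/= Bm _ /allP mon _] := and4P check.
have inter i j : interpolated (base_rays N) m (ray R (mono i j)).
  apply: interpolates_sound.
  have := mon i; rewrite mem_iota => /(_ (ltn_ord i))/allP/(_ j).
  by rewrite mem_iota => /(_ (ltn_ord j)).
move=> k km; rewrite E //.
transitivity (\sum_i \sum_j \sum_(l <- iota 0 (size (base_rays N)))
     c i j * ray R (mono i j) l * ray R (nth [::] (base_rays N) l) k).
  apply: eq_bigr => i _; apply: eq_bigr => j _; rewrite (inter i j k km) mulr_sumr.
  by apply: eq_bigr => l _; rewrite mulrA.
under eq_bigr do rewrite exchange_big; rewrite exchange_big /=.
apply: eq_big_seq => l; rewrite mem_iota /= add0n => lB.
rewrite E ?(leq_trans lB) // mulr_suml; apply: eq_bigr => i _.
by rewrite mulr_suml.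
Qed.

(** The second clause discards identically vanishing slacks, such as those of the unit vectors. *)
Definition hypermetric (e : {ffun 'I_N -> int}) :=
  in_EN R e /\ exists u, slackR R e u != 0.

Lemma quad_generated (A : 'M[R]_N) : (forall u, 0 <= quad A u) ->
  exists s : seq (R * {ffun 'I_N -> int}),
    (forall p, p \in s -> 0 < p.1 /\ hypermetric p.2) /\
    forall u, quad A u = \sum_(p <- s) p.1 * slackR R p.2 u.
Proof.
move=> A0.
suff [s [sP sE]] : conic (enum (BN N)) (@slackR R N) hypermetric (quad A).
  by exists s; split=> // u; apply: sE; rewrite mem_enum.
apply: (@support_generation R (BN N) _ (enum (BN N)) (@slackR R N)
          (fun f => exists A : 'M[R]_N, f =1 quad A)).
- move=> f c e [A' fA] _; exists (A' - c *: slack_mx R e) => u.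
  by rewrite quadB quad_slack // fA.
- by move=> e [eE _] u _; apply: slackR_ge0.
- move=> f [A' fA] f0 /hasP[u1 _ fu1].
  have {}f0 u : 0 <= f u by apply: f0; rewrite mem_enum.
  have [G [Gm gen /and3P[S0 /hasPn Snil /allP SG]]] := dd_generators.
  have hyp u z : z \in hypermetric_vectors N -> hypermetric (switch_vector u z).
    move=> zH; have [sz z1] := hypermetric_vectorsP zH.
    split; first exact: in_EN_switch.
    have [||j jm] := @mask_nil m (map (slack z) pts); rewrite ?size_map //.
      by apply: Snil; apply: (map_f (fun e => support_mask m (map (slack e) pts))).
    rewrite (nth_map [::]) // => zj; exists (switch u (nth [::] pts j)).
    by rewrite slackR_switch // intr_eq0.
  have nontriv e : hypermetric e -> has (fun u => slackR R e u != 0) (enum (BN N)).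
    by case=> _ [u eu]; apply/hasP; exists u; rewrite ?mem_enum.
  (* A function without zeros has full support, so any candidate fits; [generators_ok] ensures that
     one exists. *)
  have [/existsP[u0 /eqP fu0]|/existsPn fpos] := boolP [exists u, f u == 0]; last first.
    case: (hypermetric_vectors N) S0 hyp => // z zs _ hyp.
    have hz := hyp u1 z (mem_head _ _).
    by exists (switch_vector u1 z) => //; split=> [|u _ _]; [exact: nontriv|exact: fpos].
  pose h j := f (switch u0 (nth [::] pts j)).
  have u0E : switch u0 (nseq N false) = u0.
    by apply/ffunP => i; rewrite ffunE nth_nseq if_same addbF.
  have fE u : exists2 x, x \in [:: nseq N false] ++ pts &
     f u = f (switch u0 x) /\ forall e, slackR R e u = slackR R e (switch u0 x).
    have [x xP [/ffunP -> |uE]] := switch_surj u0 u N0; exists x => //.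
    by split=> [|e]; rewrite ?fA; [apply: quad_opp|apply: slackR_opp].
  have [||s [sP sE]] := gen h.
  - move=> j jm; rewrite /h fA (quad_switch_interpolated _ jm) -?fA //.
    by apply: eq_bigr => i _; rewrite fA.
  - by move=> j _; apply: f0.
  have {}sE j : (j < m)%N -> h j = \sum_(p <- s) p.1 * ray R p.2 j.
    by move=> jm; apply: sE; rewrite mem_iota.
  (* An empty decomposition would make f vanish at every switched point, hence everywhere. Otherwise
     any ray that occurs is supported inside f, and some candidate z is supported inside that
     ray. *)
  case: s sP sE => [|p s] sP sE.
    case/eqP: fu1; have [x + [-> _]] := fE u1.
    rewrite mem_cat inE => /orP[/eqP ->|/(nthP [::])[j jm <-]]; first by rewrite u0E.
    by rewrite -/(h j) sE // big_nil.
  have [p0 pG] := sP p (mem_head _ _).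
  have /hasP[_ /mapP[z zH ->] zp] := SG _ pG.
  have [sz z1] := hypermetric_vectorsP zH.
  exists (switch_vector u0 z); first exact: hyp.
  split=> [|u _]; first by apply: nontriv; apply: hyp.
  have [x xP [-> ->]] := fE u; rewrite slackR_switch // intr_eq0.
  move: xP; rewrite mem_cat inE => /orP[/eqP ->|/(nthP [::])[j jm <-]].
    by rewrite slack_nseq ?eqxx.
  move=> zj; rewrite -/(h j) sE // gt_eqF //.
  apply: (sumr_seq_gt0 (i := p)); rewrite ?mem_head //.
    by move=> q /sP[/ltW q0 /Gm[_ /(_ j jm)] g0]; rewrite mulr_ge0 ?ler0z.
  have [sp /(_ j jm) p20] := Gm _ pG.
  rewrite mulr_gt0 // ltr0z lt0r p20 andbT.
  rewrite -(@nth_mask m) ?sp //; apply: (submask_nth zp).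
  by rewrite nth_mask ?size_map // (nth_map [::]).
- by exists A.
- by move=> u _; apply: A0.
Qed.

End Generators.

(** * Farkas' lemma, membership and facets *)

(** Induction on s. If the implication already holds without [alpha t], then t gets weight 0;
    otherwise a violating x0 has [alpha t x0] > 0 and serves as direction of projection. *)
Lemma farkas (R : realFieldType) (V : lmodType R) (T : eqType) (s : seq T)
    (alpha : T -> V -> R) (gamma : V -> R) :
  uniq s -> (forall t, scalar (alpha t)) -> scalar gamma ->
  (forall x, {in s, forall t, alpha t x <= 0} -> gamma x <= 0) ->
  exists c : T -> R, (forall t, 0 <= c t) /\
    forall x, gamma x = \sum_(t <- s) c t * alpha t x.
Proof.
have sc0 (f : V -> R) a x : scalar f -> f (a *: x) = a * f x.
  move=> lf; have f0 : f 0 = 0 by have := lf (-1) 0 0; rewrite scaler0 addr0 mulN1r addNr.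
  by have := lf a x 0; rewrite !addr0 f0 addr0.
elim: s alpha gamma => [|t s IH] alpha gamma.
  move=> _ _ lg H; exists (fun _ => 0); split=> // x; rewrite big_nil.
  apply/eqP; rewrite eq_le H //= -oppr_le0 -mulN1r -sc0 // H //.
move=> /andP[ts us] la lg H.
have [H'|/existsNP[x0 /not_implyP[a0 /negP]]] :=
    pselect (forall x, {in s, forall t', alpha t' x <= 0} -> gamma x <= 0).
  have [c [c0 cE]] := IH _ _ us la lg H'.
  exists (fun t' => if t' == t then 0 else c t'); split=> [t'|x]; first by case: eqP.
  rewrite big_cons eqxx mul0r add0r cE; apply: eq_big_seq => t' st'.
  by case: eqP ts => // <-; rewrite st'.
rewrite -ltNge => g0.
have at0 : 0 < alpha t x0.
  rewrite ltNge; apply/negP => at0; have : gamma x0 <= 0.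
    by apply: H => t'; rewrite inE => /orP[/eqP ->|/a0].
  by rewrite leNgt g0.
pose k (f : V -> R) := f x0 / alpha t x0.
pose pr (f : V -> R) := fun x => f x - k f * alpha t x.
have lpr f : scalar f -> scalar (pr f).
  by move=> lf a x y; rewrite /pr lf la; rewrite mulrBr !mulrDr opprD addrACA mulrCA.
(* Projecting along x0 onto the kernel of alpha t reduces the claim to s. *)
have [] := IH (fun t' => pr (alpha t')) (pr gamma) us.
- by move=> t'; apply: lpr.
- exact: lpr.
- move=> x hx; pose y := - (alpha t x / alpha t x0) *: x0 + x.
  have prE f : scalar f -> f y = pr f x.
    move=> lf; rewrite /y lf /pr /k mulNr addrC; congr (_ - _).
    by rewrite mulrC mulrA mulrAC.
  rewrite -prE //; apply: H => t'; rewrite inE => /orP[/eqP ->|st'].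
    by rewrite prE // /pr /k divff ?gt_eqF // mul1r subrr.
  by rewrite prE //; apply: hx.
move=> c [c0 cE].
(* The weight of t collects the terms in [alpha t] removed by the projection; it is nonnegative
   because at x0 gamma is positive and the other functionals are at most 0. *)
pose d := k gamma - \sum_(t' <- s) c t' * k (alpha t').
have d0 : 0 <= d.
  rewrite subr_ge0; apply: (@le_trans _ _ 0).
    rewrite big_seq; apply: sumr_le0 => t' st'.
    by rewrite mulr_ge0_le0 // /k mulr_le0_ge0 ?invr_ge0 ?(ltW at0) // a0.
  by rewrite divr_ge0 ?ltW.
exists (fun t' => if t' == t then d else c t'); split=> [t'|x].
  by case: eqP.
have := cE x; rewrite {1}/pr => /eqP; rewrite subr_eq => /eqP ->.
rewrite big_cons eqxx /d mulrBl.
have -> : \sum_(t' <- s) (if t' == t then d else c t') * alpha t' x =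
    \sum_(t' <- s) c t' * alpha t' x.
  by apply: eq_big_seq => t' st'; rewrite ifN //; apply: contraNneq ts => <-.
have -> : \sum_(t' <- s) c t' * pr (alpha t') x =
    \sum_(t' <- s) c t' * alpha t' x - (\sum_(t' <- s) c t' * k (alpha t')) * alpha t x.
  by rewrite mulr_suml -sumrB; apply: eq_bigr => t' _; rewrite mulrBr mulrA.
by rewrite -addrA [- _ + _]addrC addrC.
Qed.

(** * Duality between quadratic functions and covariance matrices *)

Section Pairing.
Variables (R : realType) (N : nat).
Implicit Types (A rho : 'M[R]_N) (u : BN N) (e : {ffun 'I_N -> int}).

Local Notation sg := (signR R).

Definition pairing A rho : R := \sum_i \sum_j A i j * rho i j.

(** The unit covariance of the deterministic field u; these matrices span [in_UN] convexly. *)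
Definition outer u : 'M[R]_N := \matrix_(i, j) (sg (u i) * sg (u j)).

Lemma pairing_outer A u : pairing A (outer u) = quad A u.
Proof. by apply: eq_bigr => i _; apply: eq_bigr => j _; rewrite mxE mulrA. Qed.

Lemma pairing_unit_cov A (p : {ffun BN N -> R}) :
  pairing A (unit_cov p) = \sum_u p u * quad A u.
Proof.
under [RHS]eq_bigr do rewrite mulr_sumr.
rewrite exchange_big; apply: eq_bigr => i _.
under [RHS]eq_bigr do rewrite mulr_sumr.
rewrite exchange_big; apply: eq_bigr => j _.
by rewrite mxE mulr_sumr; apply: eq_bigr => u _; rewrite -!mulrA mulrCA.
Qed.

Lemma pairingDl (a : R) A A' rho : pairing (a *: A + A') rho = a * pairing A rho + pairing A' rho.
Proof.
rewrite /pairing mulr_sumr -big_split; apply: eq_bigr => i _ /=.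
rewrite mulr_sumr -big_split; apply: eq_bigr => j _ /=.
by rewrite !mxE mulrDl mulrA.
Qed.

Lemma pairing_sum (s : seq (R * {ffun 'I_N -> int})) (F : {ffun 'I_N -> int} -> 'M[R]_N) rho :
  pairing (\sum_(p <- s) p.1 *: F p.2) rho = \sum_(p <- s) p.1 * pairing (F p.2) rho.
Proof.
elim: s => [|p s IH]; last by rewrite !big_cons pairingDl IH.
by rewrite !big_nil; apply: big1 => i _; apply: big1 => j _; rewrite mxE mul0r.
Qed.

Lemma unit_cov_F1 (p : {ffun BN N -> R}) : is_law p -> in_F1 (unit_cov p).
Proof.
move=> [_ p1]; split=> [|i].
  by apply/matrixP => i j; rewrite !mxE; apply: eq_bigr => u _; rewrite mulrAC.
by rewrite mxE -p1; apply: eq_bigr => u _; rewrite -mulrA signR_sqr mulr1.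
Qed.

Lemma outer_in_UN u : in_UN (outer u).
Proof.
exists [ffun v => (v == u)%:R]; split; first split.
- by move=> v; rewrite ffunE ler0n.
- rewrite (bigD1 u) //= ffunE eqxx big1 ?addr0 // => v /negbTE vu.
  by rewrite ffunE vu.
apply/matrixP => i j; rewrite !mxE (bigD1 u) //= ffunE eqxx mul1r big1 ?addr0 //.
by move=> v /negbTE vu; rewrite ffunE vu !mul0r.
Qed.

Lemma pairing_slack e rho : (0 < N)%N -> in_F1 rho ->
  pairing (slack_mx R e) rho = qform rho e - 1.
Proof.
move=> N0 [_ d].
transitivity (\sum_i (\sum_j rho i j * (e i)%:~R * (e j)%:~R - N%:R^-1)).
  apply: eq_bigr => i _.
  transitivity (\sum_j (rho i j * (e i)%:~R * (e j)%:~R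
                  - (if j == i then N%:R^-1 else 0))).
    apply: eq_bigr => j _; rewrite mxE mulrBl; congr (_ - _).
      by rewrite mulrC mulrA.
    rewrite [j == i]eq_sym; case: eqP => [->|_]; last by rewrite !mul0r.
    by rewrite d mul1r mulr1.
  by rewrite sumrB -big_mkcond big_pred1_eq.
rewrite sumrB sumr_const card_ord -[_ *+ N]mulr_natl divff //.
by rewrite pnatr_eq0 -lt0n.
Qed.

Lemma quad_flip A u k : quad A u - quad A [ffun i => u i (+) (i == k)] =
  2 * sg (u k) * \sum_(j | j != k) (A k j + A j k) * sg (u j).
Proof.
set u' := [ffun i => _].
have u'k : sg (u' k) = - sg (u k) by rewrite ffunE eqxx addbT signR_neg.
have u'E i : i != k -> sg (u' i) = sg (u i) by rewrite ffunE => /negbTE ->; rewrite addbF.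
have E v : quad A v = A k k + sg (v k) * (\sum_(j | j != k) (A k j + A j k) * sg (v j)) +
    \sum_(i | i != k) \sum_(j | j != k) A i j * sg (v i) * sg (v j).
  rewrite /quad (bigD1 k) //= (bigD1 k) //= -[A k k * _ * _]mulrA signR_sqr mulr1.
  rewrite -!addrA; congr (_ + _).
  have -> : \sum_(i | i != k) \sum_j A i j * sg (v i) * sg (v j) =
      \sum_(i | i != k) A i k * sg (v i) * sg (v k) +
      \sum_(i | i != k) \sum_(j | j != k) A i j * sg (v i) * sg (v j).
    by rewrite -big_split; apply: eq_bigr => i _; rewrite (bigD1 k).
  rewrite addrA; congr (_ + _); rewrite mulr_sumr -big_split; apply: eq_bigr => j _ /=.
  by ring.
rewrite !E u'k.
have -> : \sum_(j | j != k) (A k j + A j k) * sg (u' j) =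
          \sum_(j | j != k) (A k j + A j k) * sg (u j).
  by apply: eq_bigr => j jk; rewrite u'E.
have -> : \sum_(i | i != k) \sum_(j | j != k) A i j * sg (u' i) * sg (u' j) =
          \sum_(i | i != k) \sum_(j | j != k) A i j * sg (u i) * sg (u j).
  by apply: eq_bigr => i ik; apply: eq_bigr => j jk; rewrite !u'E.
set W := \sum_(j | _) _; set Z := \sum_(i | _) _.
by ring.
Qed.

(** Flipping coordinate k isolates the terms in row and column k; comparing two points that differ
    only at l then isolates the entry. *)
Lemma quad0_offdiag A : (forall u, quad A u = 0) ->
  forall k l, k != l -> A k l + A l k = 0.
Proof.
move=> A0 k l kl.
have W0 u : \sum_(j | j != k) (A k j + A j k) * sg (u j) = 0.
  have := quad_flip A u k; rewrite !A0 subrr => /esym/eqP.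
  rewrite !mulf_eq0 pnatr_eq0 /= => /orP[|/eqP //].
  by rewrite /signR; case: (u k); rewrite ?oppr_eq0 oner_eq0.
pose u : BN N := [ffun => true]; pose v : BN N := [ffun i => i != l].
have := W0 u; have := W0 v; rewrite (bigD1 l) 1?eq_sym //= => Ev.
rewrite (bigD1 l) 1?eq_sym //=.
have -> : \sum_(i | (i != k) && (i != l)) (A k i + A i k) * sg (u i) =
          \sum_(i | (i != k) && (i != l)) (A k i + A i k) * sg (v i).
  by apply: eq_bigr => i /andP[_ il]; rewrite !ffunE il.
move: Ev; rewrite !ffunE eqxx /signR mulrN1 mulr1 => /eqP.
rewrite addrC subr_eq0 => /eqP ->; rewrite -mulr2n => /eqP.
by rewrite mulrn_eq0 => /eqP.
Qed.

(** The off-diagonal part of A is antisymmetric, so the pairing with a symmetric matrix of unit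
    diagonal is the trace of A, whichever matrix is taken; at an [outer] matrix it is 0. Thus
    equality of quadratic functions on the cube suffices for equal pairings. *)
Lemma quad0_pairing A rho : (0 < N)%N -> in_F1 rho -> (forall u, quad A u = 0) ->
  pairing A rho = 0.
Proof.
move=> N0 rF A0.
have dbl (r : 'M[R]_N) : in_F1 r -> pairing A r *+ 2 = \sum_i (A i i *+ 2).
  move=> [rT rd]; rewrite mulr2n {2}/pairing exchange_big -big_split.
  apply: eq_bigr => i _ /=; rewrite -big_split (bigD1 i) //= big1 => [|j ji].
    by rewrite addr0 rd mulr1 mulr2n.
  have -> : r j i = r i j by rewrite -{1}rT mxE.
  by rewrite -mulrDl (quad0_offdiag A0) ?mul0r // eq_sym.
suff : pairing A rho *+ 2 = 0 by move=> /eqP; rewrite mulrn_eq0 => /eqP.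
rewrite (dbl _ rF).
have [p [pl pE]] := outer_in_UN [ffun => true].
by rewrite -(dbl (outer [ffun => true])) ?pairing_outer ?A0 ?mul0rn // pE; apply: unit_cov_F1.
Qed.

(** The Farkas coefficients of the evaluations at the points u form the law; matrix units read off
    the entries of rho, and a diagonal entry gives total mass 1. *)
Lemma in_UN_criterion rho : (0 < N)%N -> in_F1 rho ->
  (forall A, (forall u, 0 <= quad A u) -> 0 <= pairing A rho) -> in_UN rho.
Proof.
move=> N0 [rT rd] H.
have [||||c [c0 cE]] := @farkas R 'M[R]_N (BN N) (enum (BN N)) (fun u A => - quad A u)
    (fun A => - pairing A rho).
- exact: enum_uniq.
- by move=> u a A A'; rewrite -!pairing_outer pairingDl opprD mulrN.
- by move=> a A A'; rewrite pairingDl opprD mulrN.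
- move=> A hA; rewrite oppr_le0; apply: H => u.
  by rewrite -oppr_le0 hA // mem_enum.
have rE i j : rho i j = \sum_u c u * sg (u i) * sg (u j).
  have deltaE (r : 'M[R]_N) : pairing (delta_mx i j) r = r i j.
    rewrite /pairing (bigD1 i) //= (bigD1 j) //= mxE !eqxx mul1r !big1 ?addr0 //.
      by move=> k /negbTE ki; apply: big1 => l _; rewrite mxE ki mul0r.
    by move=> l /negbTE lj; rewrite mxE lj andbF mul0r.
  have /eqP := cE (delta_mx i j); rewrite deltaE big_enum eqr_oppLR -sumrN => /eqP ->.
  apply: eq_bigr => u _; rewrite mulrN opprK -pairing_outer deltaE mxE.
  by rewrite mulrA.
exists [ffun u => c u]; split; first split.
- by move=> u; rewrite ffunE.
- rewrite -(rd (Ordinal N0)) rE; apply: eq_bigr => u _.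
  by rewrite ffunE -mulrA signR_sqr mulr1.
by apply/matrixP => i j; rewrite rE mxE; apply: eq_bigr => u _; rewrite ffunE.
Qed.

Lemma qform_unit_cov (p : {ffun BN N -> R}) (e : 'I_N -> int) :
  qform (unit_cov p) e = \sum_u p u * (\sum_i sg (u i) * (e i)%:~R) ^+ 2.
Proof.
have -> : qform (unit_cov p) e = pairing (\matrix_(i, j) ((e i)%:~R * (e j)%:~R)) (unit_cov p).
  by apply: eq_bigr => i _; apply: eq_bigr => j _; rewrite !mxE mulrC mulrA mulrC mulrA.
rewrite pairing_unit_cov; apply: eq_bigr => u _; congr (_ * _).
rewrite expr2 mulr_suml; apply: eq_bigr => i _; rewrite mulr_sumr; apply: eq_bigr => j _.
by rewrite mxE -mulrA mulrACA [_ * sg (u i)]mulrC [_ * sg (u j)]mulrC.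
Qed.

Lemma qform_ge1 rho (e : 'I_N -> int) : in_UN rho -> odd (absz (\sum_i e i)) ->
  1 <= qform rho e.
Proof.
move=> [p [[p0 p1] ->]] oe; rewrite qform_unit_cov -[X in X <= _]p1; apply: ler_sum => u _.
apply: ler_peMr; first exact: p0.
exact: signed_sum_sqr_ge1.
Qed.

End Pairing.

(** The homogenized points (x,1) are the rows of a matrix of full row rank with one more column than
    rows. Both (mu,-o) and (nu,-t) lie in its one-dimensional kernel, which the nonzero (nu,-t)
    spans. *)
Lemma affine_hyperplane_unique (R : fieldType) (I : finType)
    (pts : 'I_#|I| -> {ffun I -> R}) (mu nu : {ffun I -> R}) (o t : R) :
  (forall c : 'I_#|I| -> R, \sum_k c k = 0 ->
     (forall q, \sum_k c k * pts k q = 0) -> forall k, c k = 0) ->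
  (forall k, \sum_q pts k q * mu q = o) ->
  (forall k, \sum_q pts k q * nu q = t) ->
  (nu != 0) || (t != 0) ->
  exists c, o = c * t /\ forall q, mu q = c * nu q.
Proof.
move=> indep muo nut nt.
pose hom (x : {ffun I -> R}) (a : R) : 'rV[R]_(#|I| + 1) :=
  row_mx (\row_l x (enum_val l)) (const_mx a).
pose M : 'M[R]_(#|I|, #|I| + 1) :=
  row_mx (\matrix_(k, l) pts k (enum_val l)) (const_mx 1).
have Mfree : row_free M.
  apply: inj_row_free => v /rowP vM; apply/rowP => k; rewrite mxE.
  apply: (indep (v 0)) => [|q] .
    have := vM (rshift _ 0); rewrite mul_mx_row row_mxEr !mxE => vq; rewrite -[RHS]vq.
    by apply: eq_bigr => l _; rewrite mxE mulr1.
  have := vM (lshift _ (enum_rank q)); rewrite mul_mx_row row_mxEl !mxE => vq; rewrite -[RHS]vq.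
  by apply: eq_bigr => l _; rewrite mxE enum_rankK.
have homM (x : {ffun I -> R}) a : (forall k, \sum_q pts k q * x q = a) -> hom x (- a) *m M^T = 0.
  move=> xa; apply/rowP => k; rewrite /hom /M tr_row_mx mul_row_col !mxE.
  rewrite big_ord1 !mxE mulr1 -[X in _ - X](xa k).
  apply/eqP; rewrite subr_eq0; apply/eqP.
  rewrite [RHS](reindex (@enum_val I I)) /=; last first.
    by exact: onW_bij (@enum_val_bij I).
  by apply: eq_bigr => l _; rewrite !mxE mulrC.
have rk : \rank (kermx M^T) = 1%N.
  by rewrite mxrank_ker mxrank_tr (eqP Mfree) addKn.
have nu0 : hom nu (- t) != 0.
  apply: contraTneq nt => /rowP nu0; rewrite negb_or !negbK; apply/andP; split.
    apply/eqP/ffunP => q; have := nu0 (lshift _ (enum_rank q)).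
    by rewrite row_mxEl !mxE enum_rankK ffunE.
  have := nu0 (rshift _ 0); rewrite row_mxEr !mxE => /eqP.
  by rewrite oppr_eq0.
have /sub_rVP[c] : (hom mu (- o) <= hom nu (- t))%MS.
  have ker (x : {ffun I -> R}) a : (forall k, \sum_q pts k q * x q = a) -> (hom x (- a) <= kermx M^T)%MS.
    by move=> /homM h; apply/sub_kermxP.
  apply: submx_trans (ker _ _ muo) _.
  by rewrite -(mxrank_leqif_sup (ker _ _ nut)) rk rank_rV nu0.
move=> /rowP E; exists c; split=> [|q].
  have := E (rshift _ 0); rewrite /hom scale_row_mx !row_mxEr !mxE mulrN.
  by move/oppr_inj.
by have := E (lshift _ (enum_rank q)); rewrite /hom scale_row_mx !row_mxEl !mxE enum_rankK.
Qed.

(** * Hypermetric description of the polytope and its facets *)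

Section Main.
Variables (R : realType) (N : nat).
Hypothesis N0 : (0 < N)%N.
Local Notation sg := (signR R).

Lemma sum_pairs (F : 'I_N -> 'I_N -> R) :
  \sum_(i < N) \sum_(j < N) (if (i < j)%N then F i j else 0) =
  \sum_(q : pairs N) F (val q).1 (val q).2.
Proof.
rewrite pair_bigA -big_mkcond /=.
by rewrite -(big_sub [pred x : 'I_N * 'I_N | (x.1 < x.2)%N] (fun x => F x.1 x.2)).
Qed.

Lemma sum_symmetric (F : 'I_N -> 'I_N -> R) : (forall i j, F i j = F j i) ->
  \sum_i \sum_j F i j = \sum_i F i i + 2 * \sum_(q : pairs N) F (val q).1 (val q).2.
Proof.
move=> FC; rewrite -sum_pairs.
have -> : \sum_i \sum_j F i j = \sum_(i < N) (F i i + (\sum_(j < N) (if (i < j)%N then F i j else 0)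
     + \sum_(j < N) (if (j < i)%N then F j i else 0))).
  apply: eq_bigr => i _; rewrite -big_split (bigD1 i) //= [in RHS](bigD1 i) //=.
  rewrite !ltnn !add0r; congr (_ + _); apply: eq_bigr => j ji.
  case: ltngtP => [_|_|/val_inj E]; rewrite ?addr0 ?add0r //.
  by rewrite E eqxx in ji.
rewrite !big_split /=; congr (_ + _); rewrite [X in _ + X]exchange_big /=.
by rewrite -mulr2n mulr_natl.
Qed.

Lemma qform_prodvec (rho : 'M[R]_N) (e : 'I_N -> int) : in_F1 rho ->
  qform rho e = \sum_i (e i)%:~R ^+ 2 + 2 * dotp (piv rho) (prodvec R e).
Proof.
move=> [rT rd]; rewrite /qform sum_symmetric; last first.
  by move=> i j; rewrite -{1}rT mxE mulrAC.
congr (_ + 2 * _); first by apply: eq_bigr => i _; rewrite rd mul1r expr2.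
by apply: eq_bigr => q _; rewrite !ffunE intrM mulrA.
Qed.

Lemma in_UN_of_hypermetric (rho : 'M[R]_N) : dd_check N -> in_F1 rho ->
  (forall e : 'I_N -> int, in_EN R e -> 1 <= qform rho e) -> in_UN rho.
Proof.
move=> check rF H; apply: in_UN_criterion => // A A0.
have [s [sP sE]] := quad_generated N0 check A0.
(* A and its decomposition agree only as functions on the cube; their difference pairs to 0 with rho
   by [quad0_pairing]. *)
pose A' := - 1 *: (\sum_(p <- s) p.1 *: slack_mx R p.2) + A.
have : pairing A' rho = 0.
  apply: quad0_pairing => // u; rewrite -pairing_outer pairingDl pairing_sum mulN1r.
  rewrite pairing_outer sE addrC; apply/eqP; rewrite subr_eq0; apply/eqP.
  by apply: eq_bigr => p _; rewrite pairing_outer quad_slack.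
rewrite pairingDl mulN1r addrC => /eqP; rewrite subr_eq0 => /eqP ->.
rewrite pairing_sum big_seq; apply: sumr_ge0 => p /sP[/ltW p0 [eE _]].
by rewrite mulr_ge0 // pairing_slack // subr_ge0 H.
Qed.

Lemma facet_normal (mu : {ffun pairs N -> R}) : dd_check N ->
  facet_outer_normal (@in_UNstar R N) mu ->
  exists e : 'I_N -> int, in_EN R e /\
    exists c : R, c < 0 /\ forall q, mu q = c * prodvec R e q.
Proof.
move=> check [mu0 [o [valid [pts [face indep]]]]].
(* Extending mu by 0 on and below the diagonal, and spreading o over the diagonal, gives a matrix A
   whose quadratic function is o - <.,mu> on the cube. *)
pose m (i j : 'I_N) : R := if insub (i, j) is Some q then mu q else 0.
have mE (q : pairs N) : m (val q).1 (val q).2 = mu q by rewrite /m -surjective_pairing valK.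
have m0 (i j : 'I_N) : (i < j)%N = false -> m i j = 0 by move=> ij; rewrite /m insubF.
pose A : 'M[R]_N := \matrix_(i, j) ((i == j)%:R * (o / N%:R) - m i j).
have AE (rho : 'M[R]_N) : in_F1 rho -> pairing A rho = o - dotp (piv rho) mu.
  move=> [_ rd].
  have -> : dotp (piv rho) mu = \sum_i \sum_j m i j * rho i j.
    transitivity (\sum_(i < N) \sum_(j < N) (if (i < j)%N then m i j * rho i j else 0)).
      by rewrite sum_pairs; apply: eq_bigr => q _; rewrite mE ffunE mulrC.
    apply: eq_bigr => i _; apply: eq_bigr => j _.
    by case: ifP => // /m0 ->; rewrite mul0r.
  transitivity (\sum_i (o / N%:R - \sum_j m i j * rho i j)).
    apply: eq_bigr => i _; under eq_bigr do rewrite mxE mulrBl.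
    rewrite sumrB; congr (_ - _); rewrite (bigD1 i) //= eqxx rd mul1r mulr1 big1 ?addr0 //.
    by move=> j /negbTE ji; rewrite eq_sym ji !mul0r.
  rewrite sumrB sumr_const card_ord -[_ *+ N]mulr_natr divfK //.
  by rewrite pnatr_eq0 -lt0n.
have quadE u : quad A u = o - dotp (piv (outer R u)) mu.
  rewrite -pairing_outer AE //.
  by have [p [pl ->]] := outer_in_UN R u; apply: unit_cov_F1.
have A0 u : 0 <= quad A u.
  by rewrite quadE subr_ge0; apply: valid; exists (outer R u); split=> //; exact: outer_in_UN.
have [[|[c0 e] s] [sP sE]] := quad_generated N0 check A0.
  (* An empty decomposition makes [quad A] vanish, which forces mu = 0 by [quad0_offdiag]. *)
  case/eqP: mu0; apply/ffunP => q; rewrite ffunE.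
  have qlt : ((val q).1 < (val q).2)%N := valP q.
  have := @quad0_offdiag R N A _ (val q).1 (val q).2.
  rewrite !mxE mE (m0 (val q).2) ?[(val q).2 == _]eq_sym; last by rewrite ltnNge ltnW.
  have -> : ((val q).1 == (val q).2) = false by apply/eqP => E; rewrite E ltnn in qlt.
  rewrite mul0r sub0r subr0 addr0 => /(_ _ isT)/eqP; rewrite oppr_eq0 => h.
  by apply/eqP/h => u; rewrite sE big_nil.
have [/= c00 [eE [u1 eu1]]] := sP _ (mem_head _ _).
have eN0 := slackR_ge0 _ eE.
(* The offset for which the slack inequality of e reads <.,[prodvec R e]> >= t. *)
pose t : R := (1 - \sum_i (e i)%:~R ^+ 2) / 2.
have slackE u : slackR R e u = 2 * (dotp (piv (outer R u)) (prodvec R e) - t).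
  rewrite -quad_slack // -pairing_outer pairing_slack ?qform_prodvec //.
  - by rewrite /t; field.
  - by have [p [pl ->]] := outer_in_UN R u; apply: unit_cov_F1.
  - by have [p [pl ->]] := outer_in_UN R u; apply: unit_cov_F1.
have tight k : dotp (pts k) (prodvec R e) = t.
  have [[rho [[p [pl rE]] <-]] muo] := face k.
  have rF : in_F1 rho by rewrite rE; apply: unit_cov_F1.
  have pA : pairing A rho = 0 by rewrite AE // muo subrr.
  (* Multiplied by c0, this nonnegative mean is one of the nonnegative terms of [pairing A rho],
     which is 0 on the facet. *)
  have ps : \sum_u p u * slackR R e u = 0.
    have [p0 _] := pl; apply/eqP; rewrite eq_le sumr_ge0 ?andbT => [|u _].
      rewrite -(pmulr_rle0 _ c00) -[X in _ <= X]pA rE pairing_unit_cov mulr_sumr; apply: ler_sum => u _.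
      rewrite mulrCA; apply: ler_wpM2l; first exact: p0.
      rewrite sE big_cons /= lerDl big_seq; apply: sumr_ge0 => q qs.
      have [|q0 [/slackR_ge0 qE _]] := sP q; first by rewrite inE qs orbT.
      by rewrite mulr_ge0 ?qE // ltW.
    by rewrite mulr_ge0.
  have : pairing (slack_mx R e) rho = 0.
    rewrite rE pairing_unit_cov -[RHS]ps; apply: eq_bigr => u _; by rewrite quad_slack.
  rewrite pairing_slack // qform_prodvec // /t => h; lra.
have [|||c [oc muc]] := @affine_hyperplane_unique R (pairs N) pts mu (prodvec R e) o t indep.
- by move=> k; have [_] := face k.
- by move=> k; apply: tight.
- apply: contraNT eu1; rewrite negb_or !negbK => /andP[/eqP nu0 /eqP t0].
  rewrite slackE nu0 t0 subr0 /dotp big1 ?mulr0 // => q _.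
  by rewrite [X in _ * X]ffunE mulr0.
exists e; split=> //; exists c; split=> //.
have c0' : c != 0.
  by apply: contraNneq mu0 => c0'; apply/eqP/ffunP => q; rewrite muc c0' mul0r ffunE.
(* The sign is negative because the slack inequality bounds <.,[prodvec R e]> from below, while an
   outer normal bounds from above; it is read off at u1, where the slack is positive. *)
rewrite lt_neqAle c0' /=.
have s0 : 0 < slackR R e u1 by rewrite lt0r eu1 eN0.
have := A0 u1; rewrite quadE.
have -> : dotp (piv (outer R u1)) mu = c * dotp (piv (outer R u1)) (prodvec R e).
  by rewrite /dotp mulr_sumr; apply: eq_bigr => q _; rewrite muc mulrCA.
move: s0; rewrite slackE oc; set d := dotp _ _ => s0.
rewrite -mulrBr -opprB mulrN oppr_ge0 pmulr_lle0 //; lra.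
Qed.

End Main.

(** By evaluation in the virtual machine, left to the kernel at [Qed]. The check fails for N = 1,
    where there is no candidate vector. *)
Lemma dd_check_small (N : nat) : (2 <= N <= 6)%N -> dd_check N.
Proof.
have check : all dd_check (iota 2 5) by vm_cast_no_check (erefl true).
by move=> hN; apply: (allP check); rewrite mem_iota.
Qed.

Theorem theorem1 (R : realType) :
  (* (i) *)
  (forall N : nat, (1 <= N)%N -> (N <= 6)%N ->
     (forall mu : {ffun pairs N -> R},
        facet_outer_normal (@in_UNstar R N) mu ->
        exists e : 'I_N -> int, in_EN R e /\
          exists c : R, c < 0 /\ forall q, mu q = c * prodvec R e q) /\
     (forall rho : 'M[R]_N, in_F1 rho ->
        (in_UN rho <-> forall e : 'I_N -> int, in_EN R e -> 1 <= qform rho e)))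
  /\
  (* (ii) *)
  (forall N : nat, (1 <= N)%N ->
     forall rho : 'M[R]_N, in_UN rho ->
     forall e : 'I_N -> int, odd (absz (\sum_i e i)) -> 1 <= qform rho e).
Proof.
split=> [N N1 N6|N N1 rho rU e]; last exact: qform_ge1.
have necessary (rho : 'M[R]_N) : in_UN rho ->
    forall e : 'I_N -> int, in_EN R e -> 1 <= qform rho e.
  by move=> rU e /in_EN_odd; apply: qform_ge1.
have [N2|N2] := leqP 2 N.
  have check : dd_check N by apply: dd_check_small; rewrite N2.
  split=> [mu|rho rF]; first exact: facet_normal.
  by split; [exact: necessary|exact: in_UN_of_hypermetric].
(* For N = 1 there are no pairs, so no nonzero normal, and the only matrix with unit diagonal is
   (1). *)
have {}N1 : N = 1%N by apply/eqP; rewrite eqn_leq N1 -ltnS N2.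
subst N; split=> [mu [/eqP mu0 _]|rho rF].
  case: mu0; apply/ffunP => q; have : ((val q).1 < (val q).2)%N := valP q.
  by rewrite [(val q).1]ord1 [(val q).2]ord1.
split=> [|_]; first exact: necessary.
apply: in_UN_criterion => // A A0; have := A0 [ffun => true].
rewrite /quad /pairing !big_ord1 -mulrA signR_sqr mulr1.
by have [_ ->] := rF; rewrite mulr1.
Qed.
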